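(* For all $m_1,m_2\ge 3$, the parallelogram board with two holes $P(2;m_1,m_2)$ has the weak parity property.
   Context: Hexagons of the regular hexagonal tessellation of the plane are identified with points of $\mathbb{Z}^2$; two hexagons are adjacent (share an edge) iff their difference is one of $\pm(1,0),\pm(0,1),\pm(1,1)$. A board $B$ is a finite set of hexagons (positions). The $m_1\times m_2$ parallelogram board ($m_1$ columns, $m_2$ rows) is $P(m_1,m_2)=\{0,\dots,m_1-1\}\times\{0,\dots,m_2-1\}$. $B(h)$ denotes the board $B$ with $h$ holes: a configuration of $B(h)$ is a placement of $t=|B|-h$ tiles with distinct labels $1,\dots,t$ on distinct positions of $B$; the $h$ unoccupied positions are the holes (unlabeled; adjacent holes are counted separately). A slide moves a tile from its position $p$ to a hole $q$ adjacent to $p$, and is permitted iff there is another hole $r$ that is adjacent to both $p$ and $q$. The puzzle graph $puz[B(h)]$ has the configurations of $B(h)$ as vertices, with an edge between two configurations whenever one can be obtained from the other by one slide. A configuration is non-isolated if at least one slide is possible from it. $B(h)$ (or $puz[B(h)]$) has the weak parity property if whenever two non-isolated configurations with the holes in the same positions are in the same connected component of $puz[B(h)]$, one can be obtained from the other by an even permutation of the tiles. $P(2;m_1,m_2)$ is the board $P(m_1,m_2)$ with $2$ holes. *)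

(* Defs.v *)
From HB Require Import structures.
From mathcomp Require Import all_boot all_order all_fingroup all_algebra.
From mathcomp Require Import finmap.

Set Implicit Arguments.
Unset Strict Implicit.
Unset Printing Implicit Defensive.

Import GRing.Theory.
Local Open Scope ring_scope.

Notation hexagon := (int * int)%type.

Definition adjacent (p q : hexagon) : bool :=
  q - p \in [:: (1, 0); (0, 1); (1, 1); (-1, 0); (0, -1); (-1, -1)].

Definition parallelogram (m1 m2 : nat) : {fset hexagon} :=
  [fset (i%:Z, j%:Z) | i in iota 0 m1, j in iota 0 m2]%fset.

Section Puzzle.
Variables (B : {fset hexagon}) (h : nat).

(* The labels 1, ..., t are shifted to 0, ..., t - 1.  The subtraction is
   truncated, so configurations of B(h) are only meaningful for h <= |B|. *)
Definition ntiles : nat := (#|` B| - h)%N.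

(* [val c i] is the position of the tile labelled i. *)
Definition config : Type := {c : {ffun 'I_ntiles -> B} | injectiveb c}.

Definition holes (c : config) : {set B} := ~: [set val c i | i : 'I_ntiles].

Definition slide (c c' : config) : bool :=
  [exists i : 'I_ntiles, let p := val c i in let q := val c' i in
    [&& q \in holes c, adjacent (val p) (val q),
        [exists r : B, [&& r \in holes c, r != q,
           adjacent (val r) (val p) & adjacent (val r) (val q)]]
      & [forall j : 'I_ntiles, (j != i) ==> (val c' j == val c j)]]].

Definition puz : rel config := fun c c' => slide c c' || slide c' c.

Definition non_isolated (c : config) : Prop := exists c', slide c c'.

Definition even_rearrangement (c c' : config) : Prop :=
  exists s : 'S_ntiles, ~~ odd_perm s /\ forall i, val c' i = val c (s i).

Definition weak_parity_property : Prop :=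
  forall c c' : config,
    non_isolated c -> non_isolated c' -> holes c = holes c' ->
    connect puz c c' -> even_rearrangement c c'.

End Puzzle.

(* Main.v *)
Require Import Defs.
From mathcomp Require Import all_boot all_fingroup all_algebra finmap.

(** On a board with two holes [q], [r], a slide exchanges a tile at [p]
    with the hole [q], where [p], [q], [r] are the three cells of a
    triangle.  Label the two holes as well, so that a slide becomes the
    transposition of [p] and [q] on the cells of the board.  Colour the cell
    [(x, y)] by [x + y] modulo 3: the cells of a triangle have three different
    colours, so when the hole [q] is replaced by [p], the colour difference of
    the two (ordered) holes switches between [1] and [2] modulo 3.  Hence the
    sign of the permutation of the cells and the colour difference of the
    holes change together at every slide, and the one determines the other
    along any sequence of slides ([related], [slide_related]).

    If the two holes end up where the pair started, they are either fixed or
    exchanged.  When fixed, the colour difference is unchanged, so the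
    permutation of the cells is even; when exchanged, the colour difference
    has changed, so the permutation is odd, and composing it with
    the transposition of the two holes gives an even permutation again.  It
    fixes the holes, and its restriction to the tiles has the same sign
    ([extend_perm]). *)

Set Implicit Arguments.
Unset Strict Implicit.
Unset Printing Implicit Defensive.

Import GRing.Theory.

(** For adjacent cells this says that the colour of [y] is that of [x] plus
    one, where [(i, j)] has colour [i + j] modulo 3.  Around a cell, the six
    directions are alternately ascending and not. *)
Definition ascending (x y : hexagon) : bool :=
  (y - x \in [:: (1, 0); (0, 1); (-1, -1)])%R.

Lemma ascending_sym (x y : hexagon) :
  adjacent x y -> ascending y x = ~~ ascending x y.
Proof.
rewrite /adjacent /ascending -(opprB y x); set w := (y - x)%R.
by rewrite !inE => /or4P[|||/or3P[||]] /eqP ->.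
Qed.

Lemma ascending_triangle (p q r : hexagon) :
  adjacent p q -> adjacent r p -> adjacent r q ->
  ascending r p = ~~ ascending r q.
Proof.
rewrite /adjacent /ascending.
have -> : (q - p = (q - r) - (p - r))%R by rewrite opprB addrA subrK.
move: (p - r)%R (q - r)%R => u v; rewrite !inE => uv up vq; move: up vq uv.
by do 2![case/or4P=> [|||/or3P[||]] /eqP ->].
Qed.

(** The sign of a permutation survives transport along an injection: both
    sides are products of as many transpositions. *)
Lemma extend_perm (I T : finType) (f : I -> T) (s : {perm I}) :
  injective f ->
  exists t : {perm T}, [/\ odd_perm t = odd_perm s,
    forall i, t (f i) = f (s i) & forall x, x \notin codom f -> t x = x].
Proof.
move=> f_inj; have [ts -> dts] := prod_tpermP s.
elim: ts dts => [_|[i j] ts IH /= /andP[ij /IH[t [odd_t tf t_out]]]].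
  by exists 1%g; split=> [|i|x _]; rewrite ?big_nil ?odd_perm1 ?perm1.
exists (tperm (f i) (f j) * t)%g; split=> [|k|x x_out].
- by rewrite big_cons !odd_permM odd_t !odd_tperm (inj_eq f_inj).
- by rewrite big_cons !permM -inj_tperm ?tf.
- rewrite permM tpermD ?t_out //.
    by apply: contraNneq x_out => <-; apply: codom_f.
  by apply: contraNneq x_out => <-; apply: codom_f.
Qed.

Section TwoHoles.
Variable B : {fset hexagon}.
Implicit Types c d e : config B 2.

Lemma holesP c x : reflect (forall i, val c i != x) (x \in holes c).
Proof.
rewrite inE; apply: (iffP idP) => [xc i|xc].
  by apply: contraNneq xc => <-; apply: imset_f.
by apply/imsetP=> -[i _ xE]; move: (xc i); rewrite xE eqxx.
Qed.

Lemma config_inj c : injective (val c).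
Proof. exact/injectiveP/(valP c). Qed.

Lemma card_holes c : #|holes c| <= 2.
Proof.
rewrite cardsCs setCK card_imset; last exact: config_inj.
by rewrite card_ord /ntiles cardfE leq_subLR addnC -leq_subLR.
Qed.

Lemma holes_pair c (a b : B) :
  a \in holes c -> b \in holes c -> a != b -> holes c = [set a; b].
Proof.
move=> ac bc ab; apply/esym/eqP; rewrite eqEcard subUset !sub1set ac bc.
by rewrite cards2 ab card_holes.
Qed.

(** The invariant of the puzzle, with the permutation of the cells as a
    witness.  Ranging over all ordered pairs of holes, adjacent or not, makes
    this an equivalence relation, so that slides can be undone as well. *)
Definition related c d := exists s : {perm B},
  (forall i, val d i = s (val c i)) /\
  (forall a b : B, a \in holes c -> b \in holes c -> a != b ->
   odd_perm s = ascending (val a) (val b) (+) ascending (val (s a)) (val (s b))).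

Lemma related_refl c : related c c.
Proof.
by exists 1%g; split=> [i|a b *]; rewrite ?odd_perm1 !perm1 ?addbb.
Qed.

Lemma mem_holes_perm c d (s : {perm B}) :
  (forall i, val d i = s (val c i)) ->
  forall x, (s x \in holes d) = (x \in holes c).
Proof.
move=> ds x; apply/holesP/holesP => xh i; move: (xh i);
  by rewrite ds (inj_eq perm_inj).
Qed.

Lemma related_sym c d : related c d -> related d c.
Proof.
move=> [s [ds odd_s]]; exists s^-1%g; split=> [i|a b]; first by rewrite ds permK.
rewrite -{1 2 3}(permKV s a) -{1 2 3}(permKV s b) !(mem_holes_perm ds).
rewrite (inj_eq perm_inj) odd_permV => ac bc ab.
by rewrite (odd_s _ _ ac bc ab) !permKV addbC.
Qed.

Lemma related_trans c d e : related c d -> related d e -> related c e.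
Proof.
move=> [s [ds odd_s]] [t [et odd_t]]; exists (s * t)%g.
split=> [i|a b ac bc ab]; first by rewrite et ds permM.
rewrite odd_permM (odd_s _ _ ac bc ab) (odd_t (s a) (s b)).
- by rewrite !permM addbA addbK.
- by rewrite (mem_holes_perm ds).
- by rewrite (mem_holes_perm ds).
- by rewrite (inj_eq perm_inj).
Qed.

(** The exchange of the tile and the hole it moves to is odd, and replacing one
    corner of a triangle by another, seen from the third, changes the colour
    difference. *)
Lemma slide_related c d : slide c d -> related c d.
Proof.
case/existsP=> i /and4P[].
set p := val c i; set q := val d i => qc pq /existsP[r /and4P[rc rq rp rq']].
move=> /forallP still; exists (tperm p q).
have cp x : x \in holes c -> p != x by move/holesP/(_ i).
split=> [j|a b].
  have [->|ji] := eqVneq j i; first by rewrite -/p tpermL.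
  move/implyP: (still j) => /(_ ji)/eqP ->; rewrite tpermD //.
    by rewrite /p (inj_eq (@config_inj c)) eq_sym.
  by rewrite eq_sym; move/holesP: qc; apply.
rewrite odd_tperm (cp q qc).
have sr : tperm p q r = r by rewrite tpermD ?cp // eq_sym.
have tri := ascending_triangle pq rp rq'.
rewrite (holes_pair qc rc) 1?eq_sym // !inE.
(* the hole [q] that gets filled is either first or second in the pair *)
case/orP=> /eqP -> /orP[] /eqP ->; rewrite ?eqxx // => _; rewrite sr tpermR.
  rewrite ascending_sym // [ascending (val p) _]ascending_sym // tri.
  by case: ascending.
by rewrite tri; case: ascending.
Qed.

Lemma connect_related c d : connect (@puz B 2) c d -> related c d.
Proof.
case/connectP=> cs; elim: cs c => [|e cs IH] c /=.
  by move=> _ ->; apply: related_refl.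
case/andP=> ce path_cs dE; apply: related_trans (IH _ path_cs dE).
by case/orP: ce => /slide_related // /related_sym.
Qed.

Lemma non_isolated_holes c : non_isolated c ->
  exists a b : B, [/\ a \in holes c, b \in holes c, a != b
                    & adjacent (val a) (val b)].
Proof.
case=> d /existsP[i /and4P[qc _ /existsP[r /and4P[rc rq _ adj]] _]].
by exists r, (val d i).
Qed.

(** An even permutation of the cells that fixes the holes is the extension of
    an even permutation of the tiles. *)
Lemma even_rearrangement_of_perm c d (s : {perm B}) :
  (forall i, val d i = s (val c i)) -> {in holes c, forall x, s x = x} ->
  ~~ odd_perm s -> even_rearrangement c d.
Proof.
move=> ds s_fix even_s.
have tileP i : exists j, s (val c i) == val c j.
  have : s (val c i) \notin holes c.
    apply/negP=> h; have := s_fix _ h => /perm_inj sE.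
    by move/holesP: h => /(_ i); rewrite sE eqxx.
  by rewrite inE negbK => /imsetP[j _ ->]; exists j.
pose g i := xchoose (tileP i).
have gE i : s (val c i) = val c (g i) by apply/eqP/(xchooseP (tileP i)).
have g_inj : injective g.
  move=> i j gij; apply: (@config_inj c); apply: (@perm_inj _ s).
  by rewrite !gE gij.
exists (perm g_inj); split; last by move=> i; rewrite permE ds gE.
have [t [<- tc t_out]] := extend_perm (perm g_inj) (@config_inj c).
suff -> : t = s by [].
apply/permP=> x; have [/codomP[i ->]|xc] := boolP (x \in codom (val c)).
  by rewrite tc permE gE.
rewrite t_out // s_fix //; apply/holesP=> i.
by apply: contraNneq xc => <-; apply: codom_f.
Qed.

Theorem weak_parity_two_holes : weak_parity_property B 2.
Proof.
move=> c d /non_isolated_holes[a [b [ac bc ab adj]]] _ hE /connect_related.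
case=> s [ds odd_s]; have hc := holes_pair ac bc ab.
have sh x : x \in [set a; b] -> s x \in [set a; b].
  by rewrite -hc -(mem_holes_perm ds) -hE.
have [saE|sa] := eqVneq (s a) a.
  have sbE : s b = b.
    have := sh b; rewrite !inE eqxx orbT => /(_ isT)/orP[]/eqP // sba.
    by case/eqP: ab; apply: (@perm_inj _ s); rewrite saE sba.
  apply: (even_rearrangement_of_perm ds).
    by move=> x; rewrite hc !inE => /orP[]/eqP ->.
  by rewrite (odd_s a b) // saE sbE addbb.
have saE : s a = b.
  by have := sh a; rewrite !inE eqxx (negPf sa) => /(_ isT)/eqP.
have sbE : s b = a.
  have := sh b; rewrite !inE eqxx orbT => /(_ isT)/orP[]/eqP // sbb.
  by case/eqP: ab; apply: (@perm_inj _ s); rewrite saE sbb.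
apply: (@even_rearrangement_of_perm c d (s * tperm a b)%g).
- (* the tiles of [d] avoid [a] and [b] *)
  move=> i; rewrite permM -ds tpermD // eq_sym.
    by move: i; apply/holesP; rewrite -hE.
  by move: i; apply/holesP; rewrite -hE.
- by move=> x; rewrite hc !inE permM => /orP[]/eqP ->;
    rewrite ?saE ?sbE ?tpermL ?tpermR.
- rewrite odd_permM odd_tperm ab (odd_s a b) // saE sbE.
  by rewrite (ascending_sym adj); case: ascending.
Qed.

End TwoHoles.

Theorem theorem1p5 (m1 m2 : nat) (hm1 : 3 <= m1) (hm2 : 3 <= m2) :
  weak_parity_property (parallelogram m1 m2) 2.
Proof. exact: weak_parity_two_holes. Qed.
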